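(* Let $K_m$ denote the complete graph with $m$ vertices. Then, for any $n\in\mathbb{N}$ (positive integer), the graphs $K_{4n}$, $K_{4n+3}$, $(K_{4n+1})_*$ and $(K_{4n+2})_*$ admit adapted complex structures.
   Context: Given a graph $\mathcal{G}$, $\mathcal{G}_*$ denotes the disjoint union of $\mathcal{G}$ with one isolated vertex. For a finite simple graph $\mathcal{G}=(V,E)$ label $V=\{v_1,\dots,v_N\}$ and write $e_{i,j}$ ($i<j$) for the edge joining $v_i$ and $v_j$, if it exists. The Lie algebra $\mathfrak{n}_{\mathcal{G}}$ is the real vector space with basis $V\cup E$ and Lie bracket $[v_i,v_j]=e_{i,j}$ for $i<j$ if $v_i,v_j$ are adjacent, $[v_i,v_j]=0$ if they are not adjacent, and all elements of $E$ central. A complex structure on a real Lie algebra $\mathfrak{g}$ is a linear map $J:\mathfrak{g}\to\mathfrak{g}$ with $J^2=-\mathrm{Id}$ and $[x,y]+J([Jx,y]+[x,Jy])-[Jx,Jy]=0$ for all $x,y\in\mathfrak{g}$. The graph $\mathcal{G}$ admits an adapted complex structure if there is a complex structure $J$ on $\mathfrak{n}_{\mathcal{G}}$ such that for every $x\in V\cup E$ either $Jx\in V\cup E$ or $-Jx\in V\cup E$. *)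

(* Defs.v *)
From HB Require Import structures.
From mathcomp Require Import all_boot all_order all_algebra.
From mathcomp Require Import reals.

Set Implicit Arguments.
Unset Strict Implicit.
Unset Printing Implicit Defensive.

Import Order.TTheory GRing.Theory Num.Theory.
Local Open Scope ring_scope.

Record sgraph (V : finType) := SGraph {
  adj :> rel V;
  adj_sym : symmetric adj;
  adj_irr : irreflexive adj }.

Lemma complete_sym m : symmetric (fun x y : 'I_m => x != y).
Proof. by move=> x y; rewrite eq_sym. Qed.

Lemma complete_irr m : irreflexive (fun x y : 'I_m => x != y).
Proof. by move=> x; rewrite eqxx. Qed.

Definition complete (m : nat) : sgraph 'I_m :=
  SGraph (@complete_sym m) (@complete_irr m).

Definition star_rel (V : finType) (G : sgraph V) : rel (option V) :=
  fun x y => match x, y with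
             | Some u, Some v => G u v
             | _, _ => false
             end.

Lemma star_sym (V : finType) (G : sgraph V) : symmetric (star_rel G).
Proof. by move=> [x|] [y|] //=; rewrite adj_sym. Qed.

Lemma star_irr (V : finType) (G : sgraph V) : irreflexive (star_rel G).
Proof. by move=> [x|] //=; rewrite adj_irr. Qed.

(* G_* : the isolated vertex is None. *)
Definition star (V : finType) (G : sgraph V) : sgraph (option V) :=
  SGraph (@star_sym V G) (@star_irr V G).

Record lieAlgebra (R : realType) := LieAlgebra {
  lie_sort :> lmodType R;
  bracket : lie_sort -> lie_sort -> lie_sort;
  bracket_linl : forall y, linear (bracket^~ y);
  bracket_linr : forall x, linear (bracket x);
  bracketxx : forall x, bracket x x = 0;
  bracket_jacobi : forall x y z,
    bracket x (bracket y z) + bracket y (bracket z x)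
      + bracket z (bracket x y) = 0 }.

Section GraphLieAlgebra.
Variables (R : realType) (V : finType) (G : sgraph V).

(* The vertices are labelled by their position in the enumeration of V; the
   edge e_{i,j} is the pair (v_i, v_j) with i < j. *)
Definition is_edge (p : V * V) : bool :=
  (enum_rank p.1 < enum_rank p.2)%N && G p.1 p.2.

Definition edge := {p : V * V | is_edge p}.

Definition gbasis := (V + edge)%type.

(* R^o is R as a module over itself, which gives the functions their
   coordinatewise R-module structure. *)
Definition nspace := {ffun gbasis -> R^o}.

Definition bvec (a : gbasis) : nspace := [ffun b => (a == b)%:R].

Definition edge_vec (u v : V) : nspace :=
  if insub (u, v) is Some e then bvec (inr e) else 0.

(* edge_vec u v vanishes unless (u, v) is an edge in increasing order, so at
   most one of the two terms below is nonzero. *)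
Definition basis_bracket (a b : gbasis) : nspace :=
  match a, b with
  | inl u, inl v => edge_vec u v - edge_vec v u
  | _, _ => 0
  end.

Definition nbracket (x y : nspace) : nspace :=
  \sum_a \sum_b (x a * y b) *: basis_bracket a b.

Lemma nbracket_bvec a b : nbracket (bvec a) (bvec b) = basis_bracket a b.
Proof.
rewrite /nbracket (bigD1 a) //= [X in _ + X]big1 ?addr0 => [|c /negPf nca].
  rewrite (bigD1 b) //= big1 ?addr0 => [|c /negPf ncb]; rewrite !ffunE.
    by rewrite !eqxx mul1r scale1r.
  by rewrite [b == c]eq_sym ncb mulr0 scale0r.
by rewrite big1 // => d _; rewrite !ffunE [a == c]eq_sym nca mul0r scale0r.
Qed.

Lemma nbracket_edge u v (uv : is_edge (u, v)) :
  nbracket (bvec (inl u)) (bvec (inl v)) = bvec (inr (exist _ (u, v) uv)).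
Proof.
have vu : is_edge (v, u) = false.
  by apply/negbTE; case/andP: uv => /= uv _; rewrite /is_edge /= ltnNge ltnW.
rewrite nbracket_bvec /= /edge_vec insubT /= insubF //= subr0.
by congr (bvec (inr _)); apply: val_inj.
Qed.

Lemma nbracket_nonadj u v : ~~ G u v ->
  nbracket (bvec (inl u)) (bvec (inl v)) = 0.
Proof.
move=> /negPf uv; rewrite nbracket_bvec /= /edge_vec !insubF ?subrr //.
  by rewrite /is_edge /= adj_sym uv andbF.
by rewrite /is_edge /= uv andbF.
Qed.

Lemma nbracket_linl y : linear (nbracket^~ y).
Proof.
move=> k x x'; rewrite /nbracket scaler_sumr -big_split /=.
apply: eq_bigr => a _; rewrite scaler_sumr -big_split /=.
apply: eq_bigr => b _.
by rewrite !ffunE mulrDl scalerDl scalerA -mulrA.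
Qed.

Lemma basis_bracketC a b : basis_bracket a b = - basis_bracket b a.
Proof. by case: a b => [u|e] [v|f] /=; rewrite ?oppr0 ?opprB. Qed.

Lemma nbracketC x y : nbracket x y = - nbracket y x.
Proof.
rewrite /nbracket exchange_big /= -sumrN; apply: eq_bigr => a _.
rewrite -sumrN; apply: eq_bigr => b _.
by rewrite basis_bracketC scalerN mulrC.
Qed.

Lemma nbracket_linr x : linear (nbracket x).
Proof.
move=> k y y'; rewrite ![nbracket x _]nbracketC nbracket_linl.
by rewrite opprD scalerN.
Qed.


Lemma edge_vec_inl u v w : edge_vec u v (inl w) = 0.
Proof. by rewrite /edge_vec; case: insubP => [e _ _|_]; rewrite ffunE. Qed.

Lemma nbracket_inl x y w : nbracket x y (inl w) = 0.
Proof.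
rewrite /nbracket sum_ffunE big1 // => a _.
rewrite sum_ffunE big1 // => b _; rewrite ffunE.
by case: a b => [u|e] [v|f] /=; rewrite !ffunE ?edge_vec_inl ?subr0 scaler0.
Qed.

Lemma nbracket_nil x y z : nbracket x (nbracket y z) = 0.
Proof.
rewrite {1}/nbracket big1 // => a _; rewrite big1 // => -[w|e] _.
  by rewrite nbracket_inl mulr0 scale0r.
by case: a => [u|f] /=; rewrite scaler0.
Qed.

Lemma nbracketxx x : nbracket x x = 0.
Proof.
apply/ffunP => a; rewrite [RHS]ffunE; apply/eqP.
have /ffunP/(_ a)/eqP := nbracketC x x.
by rewrite [eqbRHS]ffunE -addr_eq0 -mulr2n mulrn_eq0.
Qed.

Lemma nbracket_jacobi x y z :
  nbracket x (nbracket y z) + nbracket y (nbracket z x)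
    + nbracket z (nbracket x y) = 0.
Proof. by rewrite !nbracket_nil !addr0. Qed.

Definition graph_lie : lieAlgebra R :=
  LieAlgebra nbracket_linl nbracket_linr nbracketxx nbracket_jacobi.

End GraphLieAlgebra.

Definition complex_structure (R : realType) (g : lieAlgebra R)
    (J : {linear g -> g}) : Prop :=
  (forall x, J (J x) = - x) /\
  (forall x y : g,
     bracket x y + J (bracket (J x) y + bracket x (J y))
       - bracket (J x) (J y) = 0).

Definition adapted (R : realType) (V : finType) (G : sgraph V)
    (J : {linear graph_lie R G -> graph_lie R G}) : Prop :=
  forall a : gbasis G, exists b : gbasis G,
    J (bvec R a) = bvec R b \/ - J (bvec R a) = bvec R b.

Definition admits_adapted_complex_structure (R : realType) (V : finType)
    (G : sgraph V) : Prop :=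
  exists J : {linear graph_lie R G -> graph_lie R G},
    complex_structure J /\ adapted J.

(* Main.v *)
(* For J a signed permutation of V U E, pair the vertices consecutively as
   (a, b) with J a = b, and set J[x, y] = [x, J y] whenever the pair of y comes
   after x; since J^2 = -1, this makes the Nijenhuis tensor vanish at (x, y).
   The tensor vanishes at (x, x) and (x, J x) for any J, so the edges [a, b] inside
   a pair, together with an unpaired first vertex v (for which still
   J[v, y] = [v, J y]) and the isolated vertex, are unconstrained: they may be
   matched by J in any way.  Their number is even exactly when dim n_G is, as
   in the four families. *)
Require Import Defs.
From HB Require Import structures.
From mathcomp Require Import all_boot all_order all_algebra.
From mathcomp Require Import reals.
From mathcomp Require Import zify.

Set Implicit Arguments.
Unset Strict Implicit.
Unset Printing Implicit Defensive.

Import Order.TTheory GRing.Theory Num.Theory.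
Local Open Scope ring_scope.

(** * Pairing consecutive naturals, [2k] with [2k + 1] *)

Definition flip (i : nat) : nat := if odd i then i.-1 else i.+1.

Lemma odd_flip i : odd (flip i) = ~~ odd i.
Proof. by rewrite /flip; case: ifP; lia. Qed.

Lemma flipK : involutive flip.
Proof.
by move=> i; rewrite {1}/flip odd_flip /flip; case: i => //= i; case: (odd i).
Qed.

Lemma flip_lt i n : ~~ odd n -> (i < n)%N -> (flip i < n)%N.
Proof. by rewrite /flip; case: ifP; lia. Qed.

(** The pair of [j] consists of neighbouring numbers, so nothing lies strictly between its
    members. *)
Lemma lt_flip i j : i != flip j -> (i < j)%N -> (i < flip j)%N.
Proof. by rewrite /flip; case: ifP; lia. Qed.

(** * Signed pairings of a finite type *)

Section SignedPairing.
Variable T : finType.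

(** The data of a map sending [a] to [(-1)^(s a)] times [f a] with square -1; the sign condition
    excludes fixed points. *)
Definition signed_pairing (A : {pred T}) (f : T -> T) (s : T -> bool) : Prop :=
  forall a, a \in A -> [/\ f a \in A, f (f a) = a & s (f a) = ~~ s a].

Lemma signed_pairing_exists (A : {pred T}) :
  ~~ odd #|A| -> exists f s, signed_pairing A f s.
Proof.
move=> evA; pose i a := index a (enum A).
exists (fun a => nth a (enum A) (flip (i a))), (fun a => odd (i a)) => a aA.
have ia : (flip (i a) < size (enum A))%N.
  by rewrite -cardE flip_lt // cardE index_mem mem_enum.
have iE : i (nth a (enum A) (flip (i a))) = flip (i a).
  by rewrite /i index_uniq ?enum_uniq.
split; last by rewrite iE odd_flip.
- by rewrite -mem_enum mem_nth.
- by rewrite iE flipK nth_index // mem_enum.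
Qed.

(** [f] exchanges the two signs injectively, so each sign occurs on half of [A]. *)
Lemma signed_pairing_even (A : {pred T}) f s :
  signed_pairing A f s -> ~~ odd #|A|.
Proof.
move=> fP; have le b : (#|[pred a in A | s a == b]|
    <= #|[pred a in A | s a == ~~ b]|)%N.
  rewrite -(card_in_image (f := f)) => [|x y]; last first.
    rewrite !inE => /andP[/fP[_ fx _] _] /andP[/fP[_ fy _] _] exy.
    by rewrite -fx exy fy.
  apply/subset_leq_card/subsetP => _ /imageP[a /andP[/= aA /eqP sa] ->].
  by rewrite !inE; have [-> _ ->] := fP a aA; rewrite sa eqxx.
have /eqP eqc : #|[pred a in A | s a == true]| ==
    #|[pred a in A | s a == false]|.
  by rewrite eqn_leq (le true) (le false).
have <- : (#|[pred a in A | s a == true]| +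
  #|[pred a in A | s a == false]|)%N = #|A|.
  rewrite -(cardID [pred a | s a] A); congr (_ + _)%N; apply: eq_card => a;
  by rewrite !inE ?eqb_id ?eqbF_neg // andbC.
by rewrite eqc addnn odd_double.
Qed.

(** The complement of [A] is then even too, so it is paired arbitrarily and glued to the given
    pairing. *)
Lemma signed_pairing_extend (A : {pred T}) f s :
    ~~ odd #|T| -> signed_pairing A f s ->
  exists f' s', [/\ signed_pairing predT f' s', {in A, f' =1 f}
    & {in A, s' =1 s}].
Proof.
move=> evT fP; have evA := signed_pairing_even fP.
have /signed_pairing_exists[g [t gP]] : ~~ odd #|[predC A]|.
  by move: evT; rewrite -(cardC A) oddD (negPf evA).
pose f' a := if a \in A then f a else g a.
pose s' a := if a \in A then s a else t a.
have f'A a : (f' a \in A) = (a \in A).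
  rewrite /f'; case: (boolP (a \in A)) => [/fP[]//|aA].
  by have [/negPf] := gP a aA.
exists f', s'; split.
- move=> a _; have := f'A a; rewrite /f' /s'.
  case: (boolP (a \in A)) => aA faA; rewrite faA.
    by have [_ fa sa] := fP a aA; split.
  by have [_ ga ta] := gP a aA; split.
- by move=> a aA; rewrite /f' aA.
- by move=> a aA; rewrite /s' aA.
Qed.

End SignedPairing.

(** * The Nijenhuis tensor of an endomorphism *)

Section Nijenhuis.
Variables (R : realType) (g : lieAlgebra R) (J : {linear g -> g}).

Definition nijenhuis (x y : g) : g :=
  bracket x y + J (bracket (J x) y + bracket x (J y)) - bracket (J x) (J y).

Lemma bracketC (x y : g) : bracket x y = - bracket y x.
Proof.
have linl (z u v : g) : bracket (u + v) z = bracket u z + bracket v z.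
  by have := bracket_linl z 1 u v; rewrite !scale1r.
have linr (z u v : g) : bracket z (u + v) = bracket z u + bracket z v.
  by have := bracket_linr z 1 u v; rewrite !scale1r.
have := bracketxx (x + y); rewrite linl !linr !bracketxx add0r addr0.
by move/eqP; rewrite addr_eq0 => /eqP.
Qed.

Lemma bracketZl k (x y : g) : bracket (k *: x) y = k *: bracket x y.
Proof.
have b0 : bracket 0 y = 0.
  by have := bracket_linl y (-1) 0 0; rewrite scaler0 addr0 scaleN1r addNr.
by have := bracket_linl y k x 0; rewrite b0 !addr0.
Qed.

Lemma bracketZr k (x y : g) : bracket x (k *: y) = k *: bracket x y.
Proof. by rewrite bracketC bracketZl -scalerN -bracketC. Qed.

Lemma nijenhuisC x y : nijenhuis x y = - nijenhuis y x.
Proof.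
rewrite /nijenhuis [bracket x y]bracketC [bracket (J x) y]bracketC.
rewrite [bracket x (J y)]bracketC [bracket (J x) (J y)]bracketC.
rewrite -opprD linearN -!opprD; congr (- (_ + _ + _)).
by rewrite addrC.
Qed.

Lemma nijenhuis_linl y : linear (nijenhuis^~ y).
Proof.
move=> k x x'; rewrite /nijenhuis linearP !bracket_linl.
rewrite [X in J X]addrACA -scalerDr linearP.
by rewrite [X in X - _]addrACA -scalerDr opprD addrACA -scalerN -scalerDr.
Qed.

Lemma nijenhuis0l y : nijenhuis 0 y = 0.
Proof.
by have := nijenhuis_linl y (-1) 0 0; rewrite scaler0 addr0 scaleN1r addNr.
Qed.

Hypothesis JK : forall x, J (J x) = - x.

(** [J [x, J y]] becomes [J (J [x, y]) = - [x, y]], and [J [J x, y]] cancels [[J x, J y]]. *)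
Lemma nijenhuis_commute x y :
    J (bracket x y) = bracket x (J y) ->
    J (bracket (J x) y) = bracket (J x) (J y) ->
  nijenhuis x y = 0.
Proof.
move=> Jxy JJxy; rewrite /nijenhuis linearD /= JJxy -Jxy JK.
by rewrite addrCA subrr addr0 subrr.
Qed.

Lemma nijenhuisxx x : nijenhuis x x = 0.
Proof.
rewrite /nijenhuis !bracketxx [bracket x _]bracketC subrr linear0.
by rewrite addr0 subrr.
Qed.

Lemma nijenhuis_twist x : nijenhuis x (J x) = 0.
Proof.
have N1 := bracketZr (-1); rewrite /nijenhuis JK -scaleN1r !N1 !bracketxx.
rewrite scaler0 addr0 linear0 addr0 scaleN1r opprK [bracket _ x]bracketC.
by rewrite subrr.
Qed.

End Nijenhuis.

(** * Signed permutations of the basis of a graph Lie algebra *)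

Section GraphLie.
Variables (R : realType) (V : finType) (G : sgraph V).
Implicit Types (a b : gbasis G) (x y : graph_lie R G).

Lemma graph_lie_sum x : x = \sum_a x a *: bvec R a.
Proof.
apply/ffunP => b; rewrite sum_ffunE (bigD1 b) //= big1 => [|a /negPf ab].
  by rewrite !ffunE eqxx /GRing.scale /= mulr1 addr0.
by rewrite !ffunE ab scaler0.
Qed.

Lemma nijenhuis_basis (J : {linear graph_lie R G -> graph_lie R G}) :
  (forall a b, nijenhuis J (bvec R a) (bvec R b) = 0) ->
  forall x y, nijenhuis J x y = 0.
Proof.
move=> J0; have ext y : (forall a, nijenhuis J (bvec R a) y = 0) ->
    forall x, nijenhuis J x y = 0.
  move=> y0 x; rewrite (graph_lie_sum x).
  elim/big_ind: _ => [|u v u0 v0|a _]; first exact: nijenhuis0l.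
    by rewrite -[u]scale1r nijenhuis_linl u0 v0 scaler0 addr0.
  by rewrite -[_ *: _]addr0 nijenhuis_linl y0 nijenhuis0l scaler0 addr0.
(* [ext] extends in the first argument; antisymmetry lets it serve for the second as well. *)
move=> x y; apply: (ext y) => a; rewrite nijenhuisC (ext (bvec R a)) ?oppr0 //.
Qed.

Section SignedPermutation.
Variables (f : gbasis G -> gbasis G) (s : gbasis G -> bool).
Hypothesis fP : signed_pairing predT f s.

(** In coordinates: since [f] is an involution, the entry at [b] comes from the one at [f b]. *)
Definition signed_perm (x : graph_lie R G) : graph_lie R G :=
  [ffun b => (-1) ^+ s (f b) * x (f b)].

Lemma signed_perm_linear : linear signed_perm.
Proof.
move=> k x y; apply/ffunP => b; rewrite !ffunE mulrDr /GRing.scale /=.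
by rewrite mulrCA.
Qed.

HB.instance Definition _ :=
  GRing.isLinear.Build R (graph_lie R G) (graph_lie R G) _ signed_perm
    signed_perm_linear.

Lemma signed_perm_bvec a : signed_perm (bvec R a) = (-1) ^+ s a *: bvec R (f a).
Proof.
apply/ffunP => b; rewrite !ffunE /GRing.scale /=.
have [_ fa _] := fP (isT : a \in predT).
have [_ fb _] := fP (isT : b \in predT).
have -> : (a == f b) = (f a == b).
  by apply/eqP/eqP => [->|<-]; rewrite ?fa ?fb.
by case: eqP => [<-|_]; rewrite ?fa ?mulr0.
Qed.

Lemma signed_permK x : signed_perm (signed_perm x) = - x.
Proof.
apply/ffunP => b; rewrite !ffunE.
have [_ -> ->] := fP (isT : b \in predT).
by rewrite mulrA -signr_addb addNb addbb mulN1r.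
Qed.

End SignedPermutation.
End GraphLie.

(** * The complex structure built from a pairing [tau] of the vertices outside a loose set [L] *)

Section PairedGraph.
Variables (R : realType) (V : finType) (G : sgraph V) (L : {pred V}).
Variables (tau : V -> V) (s : V -> bool).
Hypothesis tauP : signed_pairing [predC L] tau s.
Hypothesis rank_loose : forall u v,
  u \in L -> v \notin L -> (enum_rank u < enum_rank v)%N.
(** Pairs are intervals of the labelling, so [[u, v]] and [[u, tau v]] are oriented alike. *)
Hypothesis rank_tau : forall u v, v \notin L -> u != tau v ->
  (enum_rank u < enum_rank v)%N -> (enum_rank u < enum_rank (tau v))%N.
Hypothesis adj_tau : forall u v, v \notin L -> u != v -> u != tau v ->
  G u v = G u (tau v).
Hypothesis nonadj_loose : forall u v, u \in L -> v \in L -> ~~ G u v.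
Hypothesis even_dim : ~~ odd #|{: gbasis G}|.

Let tauK v : v \notin L -> tau (tau v) = v.
Proof. by case/tauP. Qed.

Let tauL v : v \notin L -> tau v \notin L.
Proof. by case/tauP. Qed.

Let sgn_tau v : v \notin L -> s (tau v) = ~~ s v.
Proof. by case/tauP. Qed.

(** The basis elements where [J] is prescribed; loose vertices and edges inside a pair are left
    over. *)
Let paired (a : gbasis G) : bool :=
  match a with
  | inl v => v \notin L
  | inr e => ((val e).2 \notin L) && ((val e).1 != tau (val e).2)
  end.

(** An edge follows its larger endpoint, and takes its sign in [basis_sgn], to obtain [J [u, v] =
    [u, J v]]. The default [e] is never reached on [paired] edges. *)
Let basis_tau (a : gbasis G) : gbasis G :=
  match a with
  | inl v => inl (tau v)
  | inr e => inr (insubd e ((val e).1, tau (val e).2))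
  end.

Let basis_sgn (a : gbasis G) : bool :=
  match a with inl v => s v | inr e => s (val e).2 end.

Let is_edge_tau u v : v \notin L -> u != tau v ->
  is_edge G (u, v) -> is_edge G (u, tau v).
Proof.
move=> vL uv /andP[/= ltuv Guv]; rewrite /is_edge /= rank_tau //=.
by rewrite -adj_tau //; apply: contraTneq ltuv => ->; rewrite ltnn.
Qed.

Let basis_tauP : signed_pairing (paired : {pred gbasis G}) basis_tau basis_sgn.
Proof.
move=> [v vL|[[u v] uv] /andP[/= vL utv]]; rewrite /in_mem /=.
  by split; rewrite ?tauL ?tauK ?sgn_tau.
have Euv := is_edge_tau vL utv uv.
have -> : insubd (exist _ (u, v) uv) (u, tau v) = exist _ (u, tau v) Euv.
  by apply: val_inj; rewrite insubdK.
have nuv : u != v by apply: contraTneq uv => ->; rewrite /is_edge /= ltnn.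
split=> /=; rewrite ?tauL ?tauK ?sgn_tau //.
by congr inr; apply: val_inj; rewrite insubdK /= ?tauK.
Qed.

Lemma admits_of_pairing : admits_adapted_complex_structure R G.
Proof.
have [f [sg [fP f_tau sg_basis]]] :=
  signed_pairing_extend even_dim basis_tauP.
have fK a : f (f a) = a by have [] := fP a isT.
have fV v : v \notin L -> f (inl v) = inl (tau v) by move=> vL; rewrite f_tau.
pose J : {linear graph_lie R G -> graph_lie R G} := signed_perm f sg.
have JE a : J (bvec R a) = (-1) ^+ sg a *: bvec R (f a).
  exact: signed_perm_bvec.
have JK x : J (J x) = - x by exact: signed_permK.
pose br := @bracket R (graph_lie R G).
have brZr k x y : br x (k *: y) = k *: br x y by exact: bracketZr.
pose comm (a b : gbasis G) :=
  J (br (bvec R a) (bvec R b)) = br (bvec R a) (J (bvec R b)).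
have comm_nij a b : comm a b -> comm (f a) b ->
    nijenhuis J (bvec R a) (bvec R b) = 0.
  move=> ab fab; apply: nijenhuis_commute => //.
  by rewrite JE !bracketZl linearZ /= fab.
have comm_vertex u v : v \notin L -> u != tau v ->
    (enum_rank u < enum_rank v)%N -> comm (inl u) (inl v).
  move=> vL utv ltuv; rewrite /comm JE brZr fV //.
  have nuv : u != v by apply: contraTneq ltuv => ->; rewrite ltnn.
  case: (boolP (G u v)) => Guv; last first.
    rewrite /br /bracket /= !nbracket_nonadj //.
      by rewrite linear0 scaler0.
    by rewrite -adj_tau.
  have Euv : is_edge G (u, v) by rewrite /is_edge /= ltuv.
  have Eutv := is_edge_tau vL utv Euv.
  rewrite /br /bracket /= (nbracket_edge R Euv) (nbracket_edge R Eutv) JE.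
  have pe : (inr (exist _ (u, v) Euv) : gbasis G) \in (paired : {pred _}).
    by rewrite /in_mem /= vL.
  rewrite sg_basis // f_tau // sg_basis //=; congr (_ *: bvec R (inr _)).
  by apply: val_inj; rewrite insubdK.
(* [Z] holds the loose vertices and all edges. It is stable under [f] because its complement, the
   paired vertices, is; brackets within [Z] vanish. *)
pose Z (a : gbasis G) := if a is inl v then v \in L else true.
have fZ a : Z a -> Z (f a).
  case E : (f a) => [v|//] /=; apply: contraTT => vL.
  by rewrite -(fK a) E fV //= tauL.
have comm_Z a b : Z a -> comm a b.
  have br0 c d : Z c -> Z d ->
      br (bvec R c) (bvec R d) = 0.
    rewrite /br /bracket /=; case: c d => [u|e] [v|e'] /= uL vL;
      try by rewrite nbracket_bvec.
    by rewrite nbracket_nonadj // nonadj_loose.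
  case: b => [v|e] Za; last first.
    by rewrite /comm JE brZr !br0 ?linear0 ?scaler0 // fZ.
  case: (boolP (v \in L)) => vL.
    by rewrite /comm JE brZr !br0 ?linear0 ?scaler0 // fZ.
  (* Here [b] is a paired vertex: a loose [a] ranks below it, and an edge [a] is central. *)
  case: a Za => [u uL|e _].
    apply: comm_vertex => //; last exact: rank_loose.
    by apply: contraTneq uL => ->; exact: tauL.
  rewrite /comm JE brZr fV // /br /bracket /= !nbracket_bvec /=.
  by rewrite linear0 scaler0.
exists J; split; last first.
  move=> a; exists (f a); rewrite JE; case: (sg a).
    by right; rewrite expr1 scaleN1r opprK.
  by left; rewrite expr0 scale1r.
split=> // x y; apply: nijenhuis_basis => {x y} a b.
have nij_Z c d : Z c -> nijenhuis J (bvec R c) (bvec R d) = 0.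
  by move=> Zc; apply: comm_nij; apply: comm_Z => //; exact: fZ.
case: (boolP (Z a)) => [/nij_Z //|].
case: (boolP (Z b)) => [/nij_Z Zb _|]; first by rewrite nijenhuisC Zb oppr0.
case: a b => [u|//] [v|//] /= vL uL.
have [->|nuv] := eqVneq u v; first exact: (nijenhuisxx J).
have [->|nutv] := eqVneq v (tau u).
  (* The partner of [u] is [J u] up to sign; the [+ 0] gives the shape required by
     [nijenhuis_linl]. *)
  have -> : bvec R (inl (tau u)) =
      (-1) ^+ sg (inl u) *: J (bvec R (inl u)) + 0.
    by rewrite JE scalerA -signr_addb addbb scale1r addr0 fV.
  rewrite nijenhuisC nijenhuis_linl nijenhuis0l.
  by rewrite [nijenhuis J (J _) _]nijenhuisC nijenhuis_twist // oppr0 scaler0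
    addr0 oppr0.
have nvtu : u != tau v by apply: contra_neq nutv => ->; rewrite tauK.
have nij_lt c d : c \notin L -> d \notin L -> c != tau d -> d != tau c ->
    c != d -> (enum_rank c < enum_rank d)%N ->
    nijenhuis J (bvec R (inl c)) (bvec R (inl d)) = 0.
  move=> cL dL cd dc ncd lt_cd; apply: comm_nij; first exact: comm_vertex.
  rewrite fV //; apply: comm_vertex => //.
    by apply: contra_neq ncd => /(congr1 tau); rewrite !tauK.
  (* [tau c] also ranks below [d]: otherwise [rank_tau] would place [d] below [tau (tau c) = c]. *)
  rewrite ltnNge; apply/negP; rewrite leq_eqVlt => /orP[/eqP/val_inj|].
    by move/enum_rank_inj/eqP; rewrite (negPf dc).
  move=> lt_dc; have := rank_tau (tauL cL) _ lt_dc.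
  by rewrite tauK // eq_sym ncd ltnNge ltnW // => /(_ isT).
case: (ltngtP (enum_rank u) (enum_rank v)) => [lt_uv|lt_vu|eq_uv].
- exact: nij_lt.
- by rewrite nijenhuisC nij_lt ?oppr0 // eq_sym.
- by move/val_inj/enum_rank_inj/eqP: eq_uv; rewrite (negPf nuv).
Qed.

End PairedGraph.

(* The vertices of rank at least o are paired consecutively; the first o ones
   stay unpaired. *)
Lemma admits_of_offset (R : realType) (V : finType) (G : sgraph V) (o : nat) :
    ~~ odd (#|V| - o) ->
    (forall u v, (enum_rank u < o)%N -> (enum_rank v < o)%N -> ~~ G u v) ->
    (forall u v w, (o <= enum_rank v)%N -> (o <= enum_rank w)%N ->
      u != v -> u != w -> G u v = G u w) ->
    ~~ odd #|{: gbasis G}| ->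
  admits_adapted_complex_structure R G.
Proof.
move=> evV nonadj adjE evG; pose r (v : V) : nat := enum_rank v.
have r_inj : injective r by move=> u v /val_inj/enum_rank_inj.
(* The pairs are the ranks [o + 2k] and [o + 2k + 1]; evenness of [#|V| - o] keeps partners in
   range. *)
pose tau v := nth v (enum V) (o + flip (r v - o)).
have r_lt v : (r v < #|V|)%N by exact: ltn_ord.
have r_tau v : (o <= r v)%N -> r (tau v) = (o + flip (r v - o))%N.
  move=> ov; have lt : (o + flip (r v - o) < #|V|)%N.
    by rewrite -ltn_subRL flip_lt // ltn_sub2r // (leq_ltn_trans ov).
  by rewrite /r /tau -(enum_val_nth v (Ordinal lt : 'I_#|{: V}|)) enum_valK.
have o_tau v : (o <= r v)%N -> (o <= r (tau v))%N.
  by move=> ov; rewrite (r_tau _ ov) leq_addr.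
have tauK v : (o <= r v)%N -> tau (tau v) = v.
  move=> ov; apply: r_inj; rewrite (r_tau _ (o_tau _ ov)) (r_tau _ ov).
  by rewrite addKn flipK subnKC.
apply: (@admits_of_pairing R V G [pred v | (r v < o)%N] tau
  (fun v => odd (r v - o))) => //.
- move=> v; rewrite !inE -!leqNgt => ov.
  by rewrite tauK // o_tau // r_tau // addKn odd_flip.
- by move=> u v; rewrite !inE -leqNgt; exact: leq_trans.
- move=> u v; rewrite !inE -leqNgt => ov nutv.
  rewrite -/(r u) -/(r v) -/(r (tau v)) r_tau // => lt_uv.
  have [uo|ou] := ltnP (r u) o; first exact: ltn_addr.
  rewrite -(subnKC ou) ltn_add2l lt_flip ?ltn_sub2rE //.
  apply: contra_neq nutv => e; apply: r_inj.
  by rewrite r_tau // -e subnKC.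
- move=> u v; rewrite !inE -leqNgt => ov nuv nutv.
  by apply: adjE => //; exact: o_tau.
Qed.

(** * Counting edges *)

(** Increasing adjacent pairs are the edges, and [swap] matches them with the decreasing ones. *)
Lemma card_edge (V : finType) (G : sgraph V) :
  (#|{: edge G}|.*2 = #|[pred p : V * V | G p.1 p.2]|)%N.
Proof.
pose lt := [pred p : V * V | (enum_rank p.1 < enum_rank p.2)%N].
rewrite card_sig -[RHS](cardID lt) -addnn; congr (_ + _)%N.
  by apply: eq_card => p; rewrite !inE /is_edge andbC.
pose swap (p : V * V) := (p.2, p.1).
have swapK : involutive swap by case.
rewrite -[RHS](card_image (inv_inj swapK)); apply: eq_card => p.
rewrite -[p in RHS]swapK (mem_image (inv_inj swapK)).
rewrite !inE /is_edge /= adj_sym -leqNgt [in RHS]leq_eqVlt.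
by case: eqP => //= /val_inj/enum_rank_inj ->; rewrite adj_irr !andbF.
Qed.

(** The adjacent ordered pairs form the complement of the diagonal. *)
Lemma card_edge_complete m : (#|{: edge (complete m)}|.*2 = m * m.-1)%N.
Proof.
rewrite card_edge; pose diag := [pred p : 'I_m * 'I_m | p.1 == p.2].
have cdiag : #|diag| = m.
  have dupI : injective (fun i : 'I_m => (i, i)) by move=> i j [].
  rewrite -[RHS](card_ord m) -[RHS](card_image dupI).
  apply: eq_card => -[i j]; rewrite !inE /=.
  apply/eqP/imageP => [->|[k _ [-> ->]]//]; by exists j.
have := cardC diag; rewrite card_prod card_ord cdiag => e.
rewrite -subn1 mulnBr muln1 -e addKn.
by apply: eq_card => p; rewrite !inE.
Qed.

Lemma card_edge_star (V : finType) (G : sgraph V) :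
  #|{: edge (star G)}| = #|{: edge G}|.
Proof.
apply: double_inj; rewrite !card_edge.
pose some2 (p : V * V) := (Some p.1, Some p.2).
have some2_inj : injective some2 by move=> [u v] [u' v'] [-> ->].
rewrite -[RHS](card_image some2_inj); apply: eq_card => -[x y].
rewrite !inE /=; apply/idP/imageP => [|[[u v] Guv [-> ->]]//].
by case: x y => [u|] [v|] //= Guv; exists (u, v).
Qed.

(** This puts the isolated vertex first in the labelling, hence among the loose vertices once
    [o > 0]. *)
Lemma enum_rank_None (T : finType) : enum_rank (None : option T) = 0%N :> nat.
Proof.
have lt0 : (0 < #|{: option T}|)%N by rewrite card_option.
have -> : None = enum_val (Ordinal lt0) :> option T.
  by rewrite (enum_val_nth None) enumT unlock.
by rewrite enum_valK.
Qed.

(** * Complete graphs, with or without an isolated vertex *)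

Lemma complete_admits (R : realType) m o :
    (o <= 1)%N -> ~~ odd (m - o) -> ~~ odd (m + #|{: edge (complete m)}|) ->
  admits_adapted_complex_structure R (complete m).
Proof.
move=> o1 evm evG; apply: (@admits_of_offset R _ _ o).
- by rewrite card_ord.
- have rank0 (w : 'I_m) : (enum_rank w < o)%N -> enum_rank w = 0%N :> nat.
    by move/leq_trans/(_ o1); rewrite ltnS leqn0 => /eqP.
  move=> u v /rank0 u0 /rank0 v0; rewrite /= negbK.
  by apply/eqP/enum_rank_inj/ord_inj; rewrite u0.
- by move=> u v w _ _ /= -> ->.
- by rewrite card_sum card_ord.
Qed.

(** The loose vertices are [None] and, if [o = 2], one vertex of the complete graph; they are not
    adjacent. *)
Lemma star_complete_admits (R : realType) m o :
    (0 < o <= 2)%N -> ~~ odd (m.+1 - o) ->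
    ~~ odd (m.+1 + #|{: edge (complete m)}|) ->
  admits_adapted_complex_structure R (star (complete m)).
Proof.
case/andP=> o1 o2 evm evG; apply: (@admits_of_offset R _ _ o).
- by rewrite card_option card_ord.
- have rank1 (w : 'I_m) : (enum_rank (Some w) < o)%N ->
      enum_rank (Some w) = 1%N :> nat.
    move=> wo; apply/eqP; rewrite eqn_leq -ltnS (leq_trans wo o2) lt0n.
    by rewrite -(enum_rank_None 'I_m) (inj_eq val_inj) (inj_eq enum_rank_inj).
  move=> [u|] [v|] //= /rank1 u1 /rank1 v1; rewrite negbK -(inj_eq Some_inj).
  by apply/eqP/enum_rank_inj/ord_inj; rewrite u1.
- have o_some (w : option 'I_m) : (o <= enum_rank w)%N -> w.
    by case: w => //; rewrite enum_rank_None leqNgt o1.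
  move=> [u|] [v|] [w|] /o_some ov /o_some ow //=.
  by rewrite !(inj_eq Some_inj) => -> ->.
- by rewrite card_sum card_option card_ord card_edge_star.
Qed.

Theorem proposition6p10 (R : realType) (n : nat) (n_gt0 : (0 < n)%N) :
  [/\ admits_adapted_complex_structure R (complete (4 * n)%N),
      admits_adapted_complex_structure R (complete (4 * n + 3)%N),
      admits_adapted_complex_structure R (star (complete (4 * n + 1)%N)) &
      admits_adapted_complex_structure R (star (complete (4 * n + 2)%N))].
Proof.
have cardE := card_edge_complete.
split.
(* Each offset has the parity of the number of vertices. The dimension is [m(m+1)/2], even for [m]
   congruent to 0 or 3 mod 4; the isolated vertex adds 1, which suits 1 and 2 mod 4. *)
- apply: (@complete_admits R _ 0) => //; first by lia.
  by have := cardE (4 * n)%N; nia.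
- apply: (@complete_admits R _ 1) => //; first by lia.
  by have := cardE (4 * n + 3)%N; nia.
- apply: (@star_complete_admits R _ 2) => //; first by lia.
  by have := cardE (4 * n + 1)%N; nia.
- apply: (@star_complete_admits R _ 1) => //; first by lia.
  by have := cardE (4 * n + 2)%N; nia.
Qed.
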